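(* Let $A$ be a totally ordered alphabet with at least two elements. For every odd integer $m\ge 1$, the set $X$ of words of length $m$ over $A$ which belong to $S_n(A)$ for some $n\ge 0$ is a comma-free code which meets every conjugacy class of primitive words of length $m$ over $A$.
   Context: $A^*$ is the set of words on $A$, $A^+$ the set of nonempty words, $A^m$ the words of length $m$. For $X\subset A^*$, $X^*$ (resp. $X^+$) is the set of products of finitely many (resp. finitely many, at least one) elements of $X$. A word is primitive if it is not a power of another word; two words are conjugate if they have the form $uv$ and $vu$. Comma-free code: a set $X\subset A^m$ is a comma-free code if for any $x\in X^+$ and $u,v\in A^*$, $uxv\in X^*$ implies $u,v\in X^*$. Radix order on $A^*$: $u<v$ if $|u|<|v|$, or $|u|=|v|$ and $u$ precedes $v$ lexicographically. Dips and superdips: for a totally ordered set (alphabet) $B$ with at least two elements, $D(B)=\{b_1b_2\cdots b_n\mid b_i\in B,\ n\ge 2,\ b_1\ge b_2\ge\dots\ge b_{n-1}<b_n\}$ (dips), and $S(B)$ (superdips) is the set of words over $B$ formed of a dip of odd length (over $B$) followed by a possibly empty sequence of dips of even length (over $B$). Define $S_0(A)=A$ and, for $n\ge1$, $S_n(A)=S(S_{n-1}(A))$, where $S_{n-1}(A)$ is viewed as an alphabet totally ordered by the restriction of the radix order of $A^*$; $S_{n-1}(A)$ is a code, so words over the alphabet $S_{n-1}(A)$ are identified with words over $A$, and $S_n(A)\subset A^+$. *)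

(* Defs.v *)
(* MathComp *)
From HB Require Import structures.
From mathcomp Require Import all_boot all_order.

Set Implicit Arguments.
Unset Strict Implicit.
Unset Printing Implicit Defensive.

Import Order.TTheory.

(* Words over A are sequences of type [seq A], and a set of words is a
   predicate [seq A -> Prop]. *)

Section Monoid.
Variable A : eqType.
Implicit Types (X : seq A -> Prop) (u v w : seq A).

Definition star X w : Prop :=
  exists ws : seq (seq A), (forall x, x \in ws -> X x) /\ w = flatten ws.

Definition plus X w : Prop :=
  exists ws : seq (seq A),
    [/\ ws <> [::], forall x, x \in ws -> X x & w = flatten ws].

Definition comma_free_code (m : nat) X : Prop :=
  (forall x, X x -> size x = m) /\
  (forall x u v, plus X x -> star X (u ++ x ++ v) -> star X u /\ star X v).

(* The exponent may be 0, so the empty word, being the 0-th power of any other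
   word, is not primitive. *)
Definition primitive w : Prop :=
  ~ exists u k, u <> w /\ w = flatten (nseq k u).

Definition conjugate w w' : Prop :=
  exists u v, w = u ++ v /\ w' = v ++ u.

End Monoid.

Section Dips.
Context {d : Order.disp_t} {T : orderType d}.
Implicit Types (B : T -> Prop) (w : seq T).
Local Open Scope order_scope.

(* The alphabet B is a subset of T with the induced order.  In [rcons s b],
   the word b_1 ... b_(n-1), [sorted >=%O] says that each letter is >= the
   next one. *)
Definition dips B w : Prop :=
  (forall b, b \in w -> B b) /\
  exists s b c, [/\ w = rcons (rcons s b) c, sorted >=%O (rcons s b) & b < c].

Definition superdips B w : Prop :=
  exists (x : seq T) (ys : seq (seq T)),
    [/\ dips B x, odd (size x),
        forall y, y \in ys -> dips B y /\ ~~ odd (size y)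
      & w = x ++ flatten ys].

End Dips.

(* [radix A] is a copy of [seq A] carrying the radix order; [seqlexi A] is the
   copy carrying the lexicographic order. *)
Fact radix_display : Order.disp_t. Proof. exact: Order.Disp tt tt. Qed.

Definition radix {d} (A : orderType d) : Type := seq A.

Section Radix.
Context {d : Order.disp_t} {A : orderType d}.

Definition radix_lt (u v : seq A) : bool :=
  (size u < size v) ||
  ((size u == size v) && ((u : seqlexi A) < (v : seqlexi A))%O).

Lemma radix_lt_irr : irreflexive radix_lt.
Proof. by move=> u; rewrite /radix_lt ltnn ltxx andbF. Qed.

Lemma radix_lt_trans : transitive radix_lt.
Proof.
move=> v u w /orP[uv|/andP[/eqP uv luv]] /orP[vw|/andP[/eqP vw lvw]];
  apply/orP.
- by left; exact: ltn_trans vw.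
- by left; rewrite -vw.
- by left; rewrite uv.
- by right; rewrite uv vw eqxx; exact: lt_trans lvw.
Qed.

HB.instance Definition _ := Choice.copy (radix A) (seq A).
HB.instance Definition _ :=
  Order.Lt_isPOrder.Build radix_display (radix A) radix_lt_irr radix_lt_trans.

Lemma radix_le_total : total (<=%O : rel (radix A)).
Proof.
move=> u v; rewrite !le_eqVlt.
change (((u == v) || radix_lt u v) || ((v == u) || radix_lt v u)).
rewrite /radix_lt; case: (ltngtP (size u) (size v)) => _ /=; rewrite ?orbT //.
by case: (ltgtP (u : seqlexi A) v); rewrite ?orbT // => ->; rewrite eqxx.
Qed.

HB.instance Definition _ :=
  Order.POrder_isTotal.Build radix_display (radix A) radix_le_total.

End Radix.

(* A word over the alphabet S_(n-1)(A) is a sequence of words over A, and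
   [flatten] identifies it with a word over A. *)
Fixpoint iter_superdips {d} (A : orderType d) (n : nat) (w : seq A) : Prop :=
  if n is k.+1 then
    exists ws : seq (radix A),
      superdips (fun x : radix A => iter_superdips k (x : seq A)) ws /\
      w = flatten (ws : seq (seq A))
  else exists a : A, w = [:: a].

(* Main.v *)
(** In a product of dips, an ascent [b < c] that follows a letter [a >= b] forces
    a cut right after [c], since no dip can end at [b].

    Comma-freeness.  Suppose [x] overlaps [w1 w2], and regard all three words as
    products of letters of S_j(A).  A superdip starts with an odd dip, which has
    length at least 3 and so forces a cut at its end; by parity a superdip
    occurring in a product of superdips contains no superdip boundary in its
    interior, and two consecutive ones are separated by a boundary.  Hence the
    inner letters of [x] at level j+1 are letters of [w1 w2], while the first
    (last) one is a suffix (prefix) of a letter of [w1 w2], which is therefore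
    larger in the radix order.  Increasing the first and the last letter of a
    product of superdips yields again a product of superdips, so the argument can
    be repeated up to the level at which [x] is one letter: then [x] is a factor
    of one letter of [w1] or of [w2], hence equal to [w1] or [w2].

    Conjugates.  A word of odd length that is not constant can be rotated
    so as to end with an ascent from its minimal letter; it is then a product of
    dips, one of them odd, and a further rotation makes it a product of an odd
    number of superdips.  A primitive word is never constant at any level, so
    iterating shows it conjugate to a single letter of some S_n(A). *)
Require Import Defs.
From mathcomp Require Import all_boot all_order.
From mathcomp Require Import zify.

Set Implicit Arguments.
Unset Strict Implicit.
Unset Printing Implicit Defensive.

Import Order.TTheory.

(** * Overlaps of two factorizations of a word *)

Section Words.
Variable A : eqType.
Implicit Types s t u v w : seq A.

Lemma cat_leq_prefix s t u v :
  s ++ t = u ++ v -> size s <= size u -> exists2 r, u = s ++ r & t = r ++ v.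
Proof.
elim: s u => [|a s IHs] [|b u] //= E; first by exists [::].
  by exists (b :: u).
by case: E => -> /IHs IH /IH [r -> ->]; exists r.
Qed.

Lemma cat_eq_size s t u v :
  s ++ t = u ++ v -> size s = size u -> s = u /\ t = v.
Proof.
move=> E su; case: (cat_leq_prefix E); first by rewrite su.
move=> r uE ->; move: su; rewrite uE size_cat -[LHS]addn0 => /addnI/esym/size0nil.
by move=> ->; rewrite cats0.
Qed.

(** The second case exhibits the first letter of the overlap, so equal cuts fall in the first case
    only. *)
Lemma cat_overlap s t u v : s ++ t = u ++ v ->
  (exists2 r, u = s ++ r & t = r ++ v) \/
  (exists a r, s = u ++ a :: r /\ v = a :: r ++ t).
Proof.
move=> E; case: (leqP (size s) (size u)) => [|lt_us].
  by move/(cat_leq_prefix E); left.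
have [[|a r] sE vE] := cat_leq_prefix (esym E) (ltnW lt_us).
  by move: lt_us; rewrite sE cats0 ltnn.
by right; exists a, r.
Qed.

Lemma flatten_seq (W : seq (seq (seq A))) :
  flatten (flatten W) = flatten (map flatten W).
Proof. by elim: W => //= g W IH; rewrite flatten_cat IH. Qed.

End Words.

(** * Dips: unique parsing and forced cuts *)

Section Dip.
Context {d : Order.disp_t} {T : orderType d}.
Implicit Types (a b c : T) (s t p q r w x : seq T) (ds es : seq (seq T)).
Local Open Scope order_scope.

(** The scan stops at the first ascent, which has to end the word. *)
Fixpoint is_dip s : bool :=
  if s is a :: s' then
    if s' is b :: t then if a < b then nilp t else is_dip s' else false
  else false.

Lemma is_dipP s : reflect
  (exists t b c, [/\ s = rcons (rcons t b) c, sorted >=%O (rcons t b) & b < c])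
  (is_dip s).
Proof.
apply: (iffP idP).
  elim: s => [|a [|b s] IHs] //=.
  case: ltP => [ab /nilP->|ba /IHs [t [b' [c [E srt bc]]]]].
    by exists [::], a, b.
  exists (a :: t), b', c; split=> //=; first by rewrite -E.
  move: E srt; case: t => [|e t] //= [<- _]; first by rewrite andbT.
  by move=> ->; rewrite andbT.
move=> [t [b [c [-> srt bc]]]]; elim: t srt => [|a t IHt] /=; first by rewrite bc.
move=> srt; have := IHt (path_sorted srt).
by case: t srt {IHt} => [|e t] /= /andP[/le_gtF -> _].
Qed.

Lemma size_dip s : is_dip s -> (1 < size s)%N.
Proof. by case: s => [|a [|b s]]. Qed.

Lemma dip_suffix p s : is_dip (p ++ s) -> (1 < size s)%N -> is_dip s.
Proof.
elim: p => //= a p IHp; case E: (p ++ s) => [|b t] //.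
have E2 : size p + size s = (size t).+1 by rewrite -size_cat E.
case: ltP => [_ /nilP t0 s2|_]; last by rewrite -E.
move: E2; rewrite t0 /= => E2; case: p {IHp E} E2 => [|? ?] /= E2; lia.
Qed.

Lemma dip_ends x : is_dip x -> exists p a b, x = p ++ [:: a; b] /\ a < b.
Proof.
move=> /is_dipP [t [b [c [-> _ bc]]]]; exists t, b, c.
by rewrite -cats1 -cats1 -catA.
Qed.

Lemma dip_stop p a b t : is_dip (p ++ [:: a, b & t]) -> a < b -> t = [::].
Proof. by move/dip_suffix => /(_ isT) /= + ab; rewrite ab => /nilP. Qed.

Lemma odd_dip_ends x : is_dip x -> odd (size x) ->
  exists p a b c, [/\ x = p ++ [:: a; b; c], b <= a & b < c].
Proof.
move=> dx; have [p [b [c [xE bc]]]] := dip_ends dx; rewrite xE size_cat addn2 /= negbK.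
case/lastP: p xE => // p a; rewrite cat_rcons => xE _.
exists p, a, b, c; split => //; move: dx; rewrite xE => /dip_suffix /(_ isT) /=.
by case: ltP.
Qed.

(** The only ascent of a dip is at its end, so it cannot properly extend another dip. *)
Lemma dip_prefix_code x y s t :
  is_dip x -> is_dip y -> x ++ s = y ++ t -> x = y /\ s = t.
Proof.
have aux x1 y1 r : is_dip x1 -> is_dip y1 -> y1 = x1 ++ r -> r = [::].
  move=> /dip_ends [p [a [b [-> ab]]]] dy yE; move: dy; rewrite yE -catA /=.
  by move/dip_stop; apply.
move=> dx dy /cat_overlap [[r yE ->]|[a [r [xE _]]]].
  by have r0 := aux _ _ _ dx dy yE; rewrite yE r0 cats0.
by have := aux _ _ _ dy dx xE.
Qed.

Lemma dips_prefix ds es t : all is_dip ds -> all is_dip es ->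
  flatten ds = flatten es ++ t ->
  exists2 ds', ds = es ++ ds' & flatten ds' = t.
Proof.
elim: es ds => [|e es IHes] ds; first by exists ds.
case: ds => [|y ds] /=; first by move=> _ /andP[]; case: e.
move=> /andP[dy dds] /andP[de des]; rewrite -catA.
move=> /(dip_prefix_code dy de) [-> /(IHes _ dds des) [ds' -> <-]].
by exists ds'.
Qed.

(* If [b <= a] then no dip ends at [b], so the dip containing [b] also contains
   [c] and stops there. *)
Lemma dips_sync ds p a b c q : all is_dip ds -> b <= a -> b < c ->
  flatten ds = p ++ [:: a; b; c] ++ q ->
  exists ds1 ds2, [/\ ds = ds1 ++ ds2, flatten ds1 = p ++ [:: a; b; c]
    & flatten ds2 = q].
Proof.
move=> + ba bc; elim: ds p => [|x ds IHds] p /=; first by move=> _; case: p.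
move=> /andP[dx dds] /cat_overlap [[r pE]|[a' [r [xE vE]]]].
  move=> /(IHds _ dds) [ds1 [ds2 [-> E1 E2]]]; exists (x :: ds1), ds2.
  by split => //=; rewrite E1 pE catA.
case: vE xE => <-; case: r => [|b' [|c' r]] /= E xE.
- have dbc : is_dip [:: b; c] by rewrite /= bc.
  have : flatten ds = flatten [:: [:: b; c]] ++ q by rewrite -E.
  case/(dips_prefix dds); first by rewrite /= bc.
  move=> ds2 -> dsE; exists [:: x; [:: b; c]], ds2.
  by rewrite /= xE -catA.
- case: E => bE E; move: dx; rewrite xE -bE => /dip_suffix /(_ isT) /=.
  by rewrite le_gtF.
case: E xE => <- <- E xE; move: (dx); rewrite xE -cat_rcons => /dip_stop /(_ bc) r0.
by exists [:: x], ds; rewrite E /= cats0 xE r0 cat_rcons.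
Qed.

(** As a suffix of a product of dips, [s] ends with an ascent; in the dip [s ++ r] an ascent can
    only be at the end. *)
Lemma dip_suffix_complete ds p s r : all is_dip ds -> flatten ds = p ++ s ->
  is_dip (s ++ r) -> (1 < size s)%N -> r = [::].
Proof.
case/lastP: ds => [|ds x]; first by case: p => //; case: s.
rewrite all_rcons flatten_rcons => /andP[/dip_ends [p' [a [b [-> ab]]]] _].
case/lastP: s => // s b'; case/lastP: s => // s a'.
rewrite -!cats1 -!catA /= => + + _.
rewrite (catA _ p') (catA p) => /(congr1 rev).
rewrite !rev_cat /= => -[<- <- _] /dip_stop; exact.
Qed.

(** * Superdip boundaries in a product of dips *)

Definition even_dip s := is_dip s && ~~ odd (size s).

(* A superdip is represented by the sequence of its dips. *)
Definition is_superdip_seq ds :=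
  if ds is x :: es then [&& is_dip x, odd (size x) & all even_dip es]
  else false.

Definition is_superdip w := exists2 g, is_superdip_seq g & w = flatten g.

(** What follows a superdip boundary satisfies this; the empty sequence is the end of the
    product. *)
Definition odd_head ds := if ds is x :: _ then odd (size x) else true.

Lemma all_even_dip es : all even_dip es -> all is_dip es.
Proof. by apply: sub_all => x /andP[]. Qed.

Lemma superdip_seq_dips g : is_superdip_seq g -> all is_dip g.
Proof. by case: g => //= x es /and3P[-> _ /all_even_dip]. Qed.

Lemma superdip_seqs_dips G : all is_superdip_seq G -> all is_dip (flatten G).
Proof.
elim: G => //= g G IHG /andP[/superdip_seq_dips dg /IHG dG].
by rewrite all_cat dg.
Qed.

Lemma superdip_seqs_odd_head G : all is_superdip_seq G -> odd_head (flatten G).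
Proof. by case: G => //= -[|x es] //= G /andP[/and3P[]]. Qed.

Lemma superdip_seqs_nil G :
  all is_superdip_seq G -> flatten (flatten G) = [::] -> G = [::].
Proof. by case: G => // -[|[|a x] es] G //= /andP[/and3P[]]. Qed.

(** Only the first dip of a superdip is odd, so every odd dip marks a boundary. *)
Lemma superdip_seq_split G ds1 x ds2 : all is_superdip_seq G ->
  flatten G = ds1 ++ x :: ds2 -> odd (size x) ->
  exists G1 G2, [/\ G = G1 ++ G2, flatten G1 = ds1 & flatten G2 = x :: ds2].
Proof.
move=> + + ox; elim: G ds1 => [|g G IHG] [|y ds1] //=.
  by move=> _ E; exists [::], (g :: G).
case: g => [|y' es] //= /andP[/and3P[_ _ des] dG] [-> E].
have [[r r1 r2]|[a [r [r1 r2]]]] := cat_overlap E.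
  have [G1 [G2 [-> E1 E2]]] := IHG _ dG r2.
  by exists ((y :: es) :: G1), G2; rewrite /= E1 r1.
case: r2 r1 des => <- _ ->; rewrite all_cat /= => /andP[_ /andP[/andP[_]]].
by rewrite ox.
Qed.

(** The word [s] has even length at least 2, hence is itself a dip, and would be the first dip of
    [ds]. *)
Lemma odd_dip_behead ds a s q : all is_dip ds -> odd_head ds ->
  is_dip (a :: s) -> odd (size (a :: s)) -> flatten ds <> s ++ q.
Proof.
move=> dds ods das /= os dsE.
have s2 : (1 < size s)%N by move: (size_dip das) os => /=; case: (size s) => [|[]].
have dse : is_dip s by apply: (@dip_suffix [:: a]).
have : flatten ds = flatten [:: s] ++ q by rewrite /= cats0.
case/(dips_prefix dds) => [|ds' dsE' _]; first by rewrite /= dse.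
by move: ods os; rewrite dsE' /= => ->.
Qed.

(** Used to rule out a superdip boundary, between [ds1] and [ds2], strictly inside an occurrence of
    [g]. *)
Lemma superdip_no_cut ds1 ds2 g p s t q : all is_dip ds1 -> all is_dip ds2 ->
  odd_head ds2 -> is_superdip_seq g -> flatten g = s ++ t ->
  s <> [::] -> t <> [::] -> flatten ds1 = p ++ s -> flatten ds2 = t ++ q -> False.
Proof.
case: g => // x es d1 d2 o2 /= /and3P[dx ox des] E s0 t0 E1 E2.
have [[r sE rE]|[a [r [xE tE]]]] := cat_overlap E; last first.
  (* The cut is inside the odd dip [x]. After one letter, what remains of [x] is an even dip; after
     two or more, an ascent precedes the cut and [x] would stop there. *)
  case: s s0 xE E1 {E} => // b [|b' s] _ xE E1.
    rewrite xE in dx ox.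
    by apply: (odd_dip_behead (q := flatten es ++ q) d2 o2 dx ox); rewrite E2 tE /= catA.
  by move: dx; rewrite xE => /(dip_suffix_complete d1 E1) /(_ isT).
(* The cut is not before the end of [x]. The end of [x] is a forced cut, so the given one falls
   between dips of [es], and [ds2] would begin with an even dip. *)
have [p' [a [b [c [xE ba bc]]]]] := odd_dip_ends dx ox.
have : flatten ds1 = (p ++ p') ++ [:: a; b; c] ++ r.
  by rewrite E1 sE xE -!catA.
case/(dips_sync d1 ba bc) => ds1' [ds1'' [ds1E _ rE']].
move: d1; rewrite ds1E all_cat => /andP[_ d1''].
move: rE; rewrite -rE' => /(dips_prefix (all_even_dip des) d1'').
move=> [[|e es'] esE tE]; first by rewrite -tE in t0.
move: des; rewrite esE all_cat /= => /andP[_ /andP[/andP[de oe] _]].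
have : flatten ds2 = flatten [:: e] ++ flatten es' ++ q.
  by rewrite E2 -tE /= cats0 catA.
case/(dips_prefix d2); first by rewrite /= de.
by move=> ds2' ds2E _; move: o2 oe; rewrite ds2E /= => ->.
Qed.

(** By [superdip_no_cut], an occurrence of [g] cannot straddle the end of a superdip of [G]. *)
Lemma superdip_occ G g p q : all is_superdip_seq G -> is_superdip_seq g ->
  flatten (flatten G) = p ++ flatten g ++ q ->
  exists G1 h G2 p' q', [/\ G = G1 ++ h :: G2, p = flatten (flatten G1) ++ p',
    q = q' ++ flatten (flatten G2) & flatten h = p' ++ flatten g ++ q'].
Proof.
move=> + dg; elim: G p => [|h G IHG] p /=.
  by case: g dg => // x es /= /and3P[+ _ _] _; case: p => //; case: x.
move=> /andP[dh dG]; rewrite flatten_cat => /cat_overlap [[r pE]|[a [r [hE E]]]].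
  move=> /(IHG _ dG) [G1 [k [G2 [p' [q' [-> rE qE kE]]]]]].
  exists (h :: G1), k, G2, p', q'; split => //=.
  by rewrite flatten_cat -catA -rE.
have [[q' aE qE]|[b [r' [gE E']]]]  := cat_overlap (u := a :: r) E.
  by exists [::], h, G, p, q'; split => //; rewrite hE aE.
exfalso; apply: (superdip_no_cut (t := b :: r') _ _ _ dg gE _ _ hE E') => //.
- exact: superdip_seq_dips.
- exact: superdip_seqs_dips.
- exact: superdip_seqs_odd_head.
Qed.

(** The odd dip opening [g] forces a cut at its end, the even dips of [g] are then parsed alike, and
    the odd dip opening [h] must start a superdip of [G]. *)
Lemma superdip_cut G g h p q : all is_superdip_seq G ->
  is_superdip_seq g -> is_superdip_seq h ->
  flatten (flatten G) = p ++ flatten g ++ flatten h ++ q ->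
  exists G1 G2, [/\ G = G1 ++ G2, flatten (flatten G1) = p ++ flatten g &
    flatten (flatten G2) = flatten h ++ q].
Proof.
move=> dG; have ddG := superdip_seqs_dips dG.
case: g => // x es /= /and3P[dx ox /all_even_dip des].
case: h => // y fs /= /and3P[dy oy _] E.
have [p' [a [b [c [xE ba bc]]]]] := odd_dip_ends dx ox.
have : flatten (flatten G) =
    (p ++ p') ++ [:: a; b; c] ++ flatten es ++ (y ++ flatten fs) ++ q.
  by rewrite E xE -!catA.
case/(dips_sync ddG ba bc) => ds1 [ds2 [GE E1 E2]].
move: (ddG); rewrite GE all_cat => /andP[dds1 dds2].
have [ds3 ds2E E3] := dips_prefix dds2 des E2.
move: dds2; rewrite ds2E all_cat => /andP[_ dds3].
have : flatten ds3 = flatten [:: y] ++ flatten fs ++ q by rewrite E3 /= cats0 -catA.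
case/(dips_prefix dds3); first by rewrite /= dy.
move=> ds4 ds3E E4.
have : flatten G = (ds1 ++ es) ++ y :: ds4 by rewrite GE ds2E ds3E -catA.
case/(superdip_seq_split dG) => // G1 [G2 [-> G1E G2E]].
exists G1, G2; split => //.
  by rewrite G1E flatten_cat E1 xE -!catA.
by rewrite G2E /= E4 catA.
Qed.

(** Induction on [H]: [superdip_cut] gives the boundary after the first superdip, [superdip_occ]
    locates that superdip, and the rest starts exactly at the boundary. *)
Lemma superdips_sync G H p q : all is_superdip_seq G -> all is_superdip_seq H ->
  H <> [::] -> flatten (flatten G) = p ++ flatten (flatten H) ++ q ->
  let W := map flatten G in let X := map flatten H in
  exists W1 W2 p' q', [/\ p = flatten W1 ++ p', q = q' ++ flatten W2 &
    (exists2 x, X = [:: x] & W = W1 ++ (p' ++ x ++ q') :: W2) \/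
    (exists x M y, X = x :: rcons M y /\
       W = W1 ++ (p' ++ x) :: M ++ (y ++ q') :: W2)].
Proof.
elim: H G p => // h [|h' H] IHH G p dG /= /andP[dh dH] _.
  rewrite cats0 => /(superdip_occ dG dh).
  move=> [G1 [k [G2 [p' [q' [-> -> -> kE]]]]]].
  exists (map flatten G1), (map flatten G2), p', q'.
  rewrite !flatten_seq; split => //; left; exists (flatten h) => //.
  by rewrite map_cat /= kE.
rewrite !flatten_cat -!catA => E.
case/andP: (dH) => dh' _.
have [G1 [G2 [GE E1 E2]]] := superdip_cut dG dh dh' E.
move: dG; rewrite GE all_cat => /andP[dG1 dG2].
have E2' : flatten (flatten G2) = [::] ++ flatten (flatten (h' :: H)) ++ q.
  by rewrite /= flatten_cat -catA.
have [W1 [W2 [p' [q' [+ qE alt]]]]] := IHH _ _ dG2 dH (ltac:(done)) E2'.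
case: p' alt => [|? ?] alt; last by case: (flatten W1).
rewrite cats0 => W1E.
(* The words of [W1] are superdips, hence nonempty, while their product is empty. *)
have W10 : W1 = [::].
  have W2E : map flatten G2 = W1 ++ drop (size W1) (map flatten G2).
    by case: alt => [[? _ ->]|[? [? [? [_ ->]]]]]; rewrite drop_size_cat.
  have : exists G3, map flatten G3 = W1 /\ all is_superdip_seq G3.
    exists (take (size W1) G2); rewrite map_take W2E take_size_cat //; split => //.
    by move: dG2; rewrite -{1}(cat_take_drop (size W1) G2) all_cat => /andP[].
  case=> G3 [W1G3 /superdip_seqs_nil G30]; move: W1E; rewrite -W1G3 -flatten_seq.
  by move/esym/G30 => ->.
have E1' : flatten (flatten G1) = p ++ flatten h ++ [::] by rewrite cats0.
have [G3 [k [G4 [p'' [q'' [G1E pE /esym q''E kE]]]]]] := superdip_occ dG1 dh E1'.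
have [q0 G40] : q'' = [::] /\ G4 = [::].
  case: q'' q''E {kE} => // q''E; split => //.
  move: dG1; rewrite G1E all_cat => /andP[_] /= /andP[_ dG4].
  exact: superdip_seqs_nil q''E.
exists (map flatten G3), W2, p'', q'; split => //.
  by rewrite pE flatten_seq.
rewrite G1E G40 !map_cat /= kE q0 cats0 -catA; right.
rewrite W10 in alt; case: alt => [[x xE ->]|[x [M [y [xE ->]]]]].
  by exists (flatten h), [::], x; split => //; case: xE => -> ->.
by exists (flatten h), (x :: M), y; split => //; case: xE => -> ->.
Qed.

(** If [s] were a single letter, the head would belong to the final ascent, which raising it could
    destroy. *)
Lemma dip_incr_head a b s : is_dip (a :: s) -> (1 < size s)%N -> a <= b ->
  is_dip (b :: s).
Proof.
case: s => [|c [|e s]] //=; case: (ltP a c) => // ca dce _ ab.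
by rewrite le_gtF //; exact: le_trans ab.
Qed.

Lemma dip_incr_last s a b : is_dip (rcons s a) -> a <= b -> is_dip (rcons s b).
Proof.
move=> /is_dipP [t [b' [c [/rcons_inj [-> ->] srt lt_b'c]]]] cb.
by apply/is_dipP; exists t, b', b; split => //; exact: lt_le_trans cb.
Qed.

Lemma superdip_size w : is_superdip w -> odd (size w) /\ (2 < size w)%N.
Proof.
case=> -[|x es] //= /and3P[dx ox des] ->.
have o : odd (size (flatten es)) = false.
  elim: es des => //= e es IHes /andP[/andP[_ oe] /IHes].
  by rewrite size_cat oddD (negbTE oe).
rewrite size_cat oddD ox o; split => //.
by rewrite ltn_addr //; case: (size x) (size_dip dx) ox => [|[|[]]].
Qed.

Lemma superdip_incr_head a b s :
  is_superdip (a :: s) -> a <= b -> is_superdip (b :: s).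
Proof.
case=> -[|x es] // /and3P[]; case: x => // c x dx ox des [-> sE] cb.
have x2 : (1 < size x)%N by move: (size_dip dx) ox => /=; case: (size x) => [|[]].
exists ((b :: x) :: es); last by rewrite sE.
by apply/and3P; split => //; apply: dip_incr_head cb.
Qed.

Lemma superdip_incr_last s a b :
  is_superdip (rcons s a) -> a <= b -> is_superdip (rcons s b).
Proof.
case=> g; case/lastP: g => // g e dg; rewrite flatten_rcons => sE ab.
case/lastP: e dg sE => [|e c] dg.
  by have := superdip_seq_dips dg; rewrite all_rcons.
rewrite -rcons_cat => /rcons_inj [-> ac]; subst c.
have de := dip_incr_last _ ab.
exists (rcons g (rcons e b)); last by rewrite flatten_rcons rcons_cat.
case: g dg => [|x g] /=.
  by rewrite !size_rcons => /and3P[/de -> -> _].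
rewrite !all_rcons /even_dip !size_rcons.
by move=> /and4P[-> -> /andP[/de -> ->] ->].
Qed.

Lemma superdip_seqsP (W : seq (seq T)) : {in W, forall w, is_superdip w} ->
  exists2 G, all is_superdip_seq G & W = map flatten G.
Proof.
elim: W => [|w W IHW] dW; first by exists [::].
have [g dg wE] := dW _ (mem_head _ _).
case: IHW => [v vW|G dG ->]; first by apply: dW; rewrite inE vW orbT.
by exists (g :: G); rewrite /= ?dg -?wE.
Qed.

(* An occurrence of a product of superdips whose first and last letters may have
   been increased. *)
Lemma superdips_loose_sync (W X : seq (seq T)) p q m (x y z t : T) :
  {in W, forall w, is_superdip w} -> {in X, forall w, is_superdip w} ->
  flatten W = p ++ y :: m ++ z :: q -> flatten X = x :: rcons m t ->
  x <= y -> t <= z ->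
  exists W1 W2 p' q', [/\ p = flatten W1 ++ p', q = q' ++ flatten W2 &
    (X = [:: x :: rcons m t] /\ W = W1 ++ (p' ++ y :: m ++ z :: q') :: W2) \/
    (exists v M w, X = (x :: v) :: rcons M (rcons w t) /\
       W = W1 ++ (p' ++ y :: v) :: M ++ (w ++ z :: q') :: W2)].
Proof.
move=> dW dX WE XE xy tz.
have [G dG WG] := superdip_seqsP dW.
(* The exact case, to be applied to [X] with its end letters raised to [y] and [z]. *)
have sync X' : {in X', forall w, is_superdip w} -> flatten X' = y :: rcons m z ->
  exists W1 W2 p' q', [/\ p = flatten W1 ++ p', q = q' ++ flatten W2 &
    (exists2 x, X' = [:: x] & W = W1 ++ (p' ++ x ++ q') :: W2) \/
    (exists x M y, X' = x :: rcons M y /\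
       W = W1 ++ (p' ++ x) :: M ++ (y ++ q') :: W2)].
  move=> /superdip_seqsP [H dH X'E] fE.
  rewrite X'E WG; apply: superdips_sync => //.
    by move=> H0; move: fE; rewrite X'E H0.
  by rewrite !flatten_seq -WG -X'E WE fE /= cat_rcons.
case: X dX XE => [|v X] dX //=.
have dv := dX _ (mem_head _ _).
case: v dX dv => [|x' v] dX dv; first by case: (superdip_size dv).
case=> x'x; subst x'; have dv' := superdip_incr_head dv xy.
case/lastP: X dX => [|M w] dX.
  rewrite cats0 => vE; subst v.
  have dX' := superdip_incr_last (s := y :: m) dv' tz.
  have [|//|W1 [W2 [p' [q' [pE qE alt]]]]] := sync [:: y :: rcons m z].
  - by move=> u; rewrite inE => /eqP->.
  - by rewrite /= cats0.
  exists W1, W2, p', q'; split => //; left; split => //.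
  case: alt => [[u [<-] ->]|[u [[|? ?] [? [//]]]]].
  by rewrite /= cat_rcons.
have dw : is_superdip w by apply: dX; rewrite inE mem_rcons mem_head orbT.
case/lastP: w dX dw => [|w t'] dX dw; first by case: (superdip_size dw).
rewrite flatten_rcons catA -rcons_cat => /rcons_inj [mE tE]; subst t'.
have dw' := superdip_incr_last dw tz.
have [|//|W1 [W2 [p' [q' [pE qE alt]]]]] := sync ((y :: v) :: rcons M (rcons w z)).
- move=> u; rewrite inE mem_rcons inE => /or3P[/eqP->|/eqP->|uM] //.
  by apply: dX; rewrite inE mem_rcons inE uM !orbT.
- by rewrite /= flatten_rcons -mE -catA !rcons_cat.
exists W1, W2, p', q'; split => //; right; exists v, M, w; split => //.
case: alt => [[u]|[u [M' [w' [[<- /rcons_inj [<- <-]] ->]]]]].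
  by case: (M).
by rewrite cat_rcons.
Qed.

(** The first dip of [X] is odd, so [odd_dip_behead] applies to it. *)
Lemma superdips_no_behead (W X : seq (seq T)) (x : T) s q :
  {in W, forall w, is_superdip w} -> {in X, forall w, is_superdip w} ->
  flatten X = x :: s -> flatten W <> s ++ q.
Proof.
move=> /superdip_seqsP [G dG ->]; case: X => // v X dX /=.
have [[|y es] //= /and3P[dy oy _] ->] := dX _ (mem_head _ _).
case: y dy oy => //= a y dy oy [_ <-]; rewrite -!catA -flatten_seq.
apply: odd_dip_behead dy oy; first exact: superdip_seqs_dips.
exact: superdip_seqs_odd_head.
Qed.

(** If [X] is a single dip, [s] already ends with an ascent, so the dip would stop before [x].
    Otherwise the odd first dip forces a cut, the parses agree from there on, and the truncated last
    dip would begin with a dip. *)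
Lemma superdips_no_belast (W X : seq (seq T)) p s (x : T) :
  {in W, forall w, is_superdip w} -> {in X, forall w, is_superdip w} ->
  flatten X = rcons s x -> flatten W <> p ++ s.
Proof.
move=> /superdip_seqsP [G dG ->] /superdip_seqsP [H dH ->].
rewrite -!flatten_seq => HE GE.
have dds := superdip_seqs_dips dG.
have : all is_dip (flatten H) := superdip_seqs_dips dH.
have : odd_head (flatten H) := superdip_seqs_odd_head dH.
case: (flatten H) HE => [|y ds] /=; first by case: s {GE}.
move=> E oy /andP[dy ds_dips].
case/lastP: ds E ds_dips => [|ds e].
  rewrite cats0 => yE _; rewrite yE -cats1 in dy.
  have := dip_suffix_complete dds GE dy; move: oy.
  rewrite yE size_rcons => /= /negbTE os s2; suff : [:: x] = [::] by [].
  apply: s2; move: (size_dip dy); rewrite size_cat addn1 ltnS.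
  by case: (size s) os => [|[]].
rewrite all_rcons flatten_rcons => E /andP[de dds'].
have [a [b [c [d' [yE ba bc]]]]] := odd_dip_ends dy oy.
case/lastP: e E de => [|e x'] // E de.
move: E; rewrite catA -rcons_cat => /rcons_inj [sE _].
have : flatten (flatten G) = (p ++ a) ++ [:: b; c; d'] ++ (flatten ds ++ e).
  by rewrite GE -sE yE -!catA.
case/(dips_sync dds ba bc) => ds1 [ds2 [GE' _ E2]].
move: (dds); rewrite GE' all_cat => /andP[_ dds2].
have [ds3 dsE E3] := dips_prefix dds2 dds' E2.
have e2 : (0 < size e)%N by move: (size_dip de); rewrite size_rcons ltnS.
move: dds2; rewrite dsE all_cat => /andP[_ dds3].
move: (de); rewrite -cats1 => de'.
case: ds3 E3 dds3 {dsE} => [|f ds3] /= E3; first by rewrite -E3 in e2.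
move=> /andP[df _].
have : f ++ (flatten ds3 ++ [:: x']) = rcons e x' ++ [::].
  by rewrite catA E3 cats1 cats0.
by case/(dip_prefix_code df de) => _; case: (flatten ds3).
Qed.

Lemma superdips_incr_head (X : seq (seq T)) s (x y : T) :
  {in X, forall w, is_superdip w} -> flatten X = x :: s -> x <= y ->
  exists2 X' : seq (seq T), {in X', forall w, is_superdip w} & flatten X' = y :: s.
Proof.
case: X => // v X dX.
have dv := dX _ (mem_head _ _).
case: v dX dv => [|x' v] dX dv; first by case: (superdip_size dv).
case=> x'x <- xy; subst x'; exists ((y :: v) :: X) => // w; rewrite inE => /orP[/eqP->|wX].
  exact: superdip_incr_head xy.
by apply: dX; rewrite inE wX orbT.
Qed.

Lemma superdips_incr_last (X : seq (seq T)) s (x y : T) :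
  {in X, forall w, is_superdip w} -> flatten X = rcons s x -> x <= y ->
  exists2 X' : seq (seq T), {in X', forall w, is_superdip w} &
    flatten X' = rcons s y.
Proof.
case/lastP: X => [|X v] dX; first by case: s.
have dv : is_superdip v by apply: dX; rewrite mem_rcons mem_head.
case/lastP: v dX dv => [|v x'] dX dv; first by case: (superdip_size dv).
rewrite flatten_rcons -rcons_cat => /rcons_inj [<- x'x] xy; subst x'.
exists (rcons X (rcons v y)) => [w|]; last by rewrite flatten_rcons rcons_cat.
rewrite mem_rcons inE => /orP[/eqP->|wX]; first exact: superdip_incr_last xy.
by apply: dX; rewrite mem_rcons inE wX orbT.
Qed.

End Dip.

(** * Agreement with the predicates [dips] and [superdips] *)

Section Superdips.
Context {d : Order.disp_t} {T : orderType d}.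
Implicit Types (B : T -> Prop) (w : seq T).

Lemma dipsP B w :
  dips B w <-> {in w, forall b, B b} /\ is_dip w.
Proof. by split=> -[Bw /is_dipP]. Qed.

Lemma superdipsP B w :
  superdips B w <-> {in w, forall b, B b} /\ is_superdip w.
Proof.
split=> [[x [es [/dipsP [Bx dx] ox des ->]]]|[Bw [[|x es] // /and3P[dx ox des] wE]]].
  split=> [b|].
    rewrite mem_cat => /orP[/Bx //|/flattenP [e /des [/dipsP [Be _] _]]]; exact: Be.
  exists (x :: es) => //; apply/and3P; split => //.
  by apply/allP => e /des [/dipsP [_ de] oe]; rewrite /even_dip de.
exists x, es; split => //.
  by apply/dipsP; split=> // b bx; apply: Bw; rewrite wE mem_cat bx.
move=> e e_es; have /andP[de oe] := allP des _ e_es; split => //.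
apply/dipsP; split=> // b be; apply: Bw; rewrite wE mem_cat; apply/orP; right.
by apply/flattenP; exists e.
Qed.

End Superdips.

(** * Successive groupings into superdips, and overlaps *)

Section Tower.
Context {d : Order.disp_t} {A : orderType d}.
Implicit Types (W X : seq (radix A)) (u v w x : seq A).

Definition join W : radix A := flatten (W : seq (seq A)).
Arguments join W : simpl never.

Lemma join_cat W X : join (W ++ X) = (join W : seq A) ++ join X.
Proof. exact: flatten_cat. Qed.

Lemma join_cons (w : radix A) W : join (w :: W) = (w : seq A) ++ join W.
Proof. by []. Qed.

Lemma join_flatten (Ws : seq (seq (radix A))) :
  join (flatten Ws) = join (map join Ws).
Proof. exact: (flatten_seq (A := A)). Qed.

(** [W] can be grouped [k] times into superdips, ending with a single letter. The recursion starts
    from the finest level, whereas that of [iter_superdips] starts from the coarsest; overlaps are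
    followed from fine to coarse. *)
Fixpoint tower k W : Prop :=
  if k is k'.+1 then
    exists Ws : seq (seq (radix A)),
      [/\ {in Ws, forall g, is_superdip g}, W = flatten Ws & tower k' (map join Ws)]
  else exists w, W = [:: w].

Lemma tower_exists j k w : iter_superdips (j + k) w ->
  exists W, [/\ {in W, forall x, iter_superdips j x}, join W = w & tower k W].
Proof.
elim: k j => [|k IHk] j.
  rewrite addn0 => Sw; exists [:: w : radix A]; split.
  - by move=> x; rewrite inE => /eqP->.
  - exact: cats0.
  - by exists (w : radix A).
rewrite addnS -addSn => /IHk [V [SV <- tV]].
have [Ws [SWs dWs VE]] : exists Ws : seq (seq (radix A)),
    [/\ {in flatten Ws, forall x, iter_superdips j x},
     {in Ws, forall g, is_superdip g} & V = map join Ws].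
  elim: V SV {tV} => [|v V IHV] SV; first by exists [::].
  have [ws [/superdipsP [Bws dws] vE]] := SV _ (mem_head _ _).
  case: IHV => [x xV|Ws [SWs dWs ->]]; first by apply: SV; rewrite inE xV orbT.
  exists (ws :: Ws); split => /=.
  - by move=> x; rewrite mem_cat => /orP[/Bws|/SWs].
  - by move=> x; rewrite inE => /orP[/eqP->|/dWs].
  - by rewrite vE.
exists (flatten Ws); split => //; first by rewrite join_flatten VE.
by exists Ws; split => //; rewrite -VE.
Qed.

(** Here the radix order enters: a proper extension is longer, hence larger. *)
Lemma radix_le_catl (u v : radix A) : (v <= (u ++ v : radix A))%O.
Proof.
case: u => [|a u]; first exact: lexx.
apply: ltW; change (radix_lt v (a :: u ++ v)).
by rewrite /radix_lt /= size_cat ltnS leq_addl.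
Qed.

Lemma radix_le_catr (u v : radix A) : (u <= (u ++ v : radix A))%O.
Proof.
case: v => [|a v]; first by rewrite cats0; exact: lexx.
apply: ltW; change (radix_lt u (u ++ a :: v)).
by rewrite /radix_lt /= size_cat /= addnS ltnS leq_addr.
Qed.

(* The letters of [X] occur at consecutive places of [L], except that the first
   one may be a proper suffix and the last one a proper prefix of the letter of
   [L] it sits in. *)
Variant loose_occ u v L X : Prop :=
| LooseOne (p q : seq (radix A)) (a b x : radix A) of X = [:: x] & L = p ++ (a ++ x ++ b) :: q
    & u = (join p : seq A) ++ a & v = (b : seq A) ++ join q
| LooseMany (p q m : seq (radix A)) (a b x y : radix A) of X = x :: rcons m y
    & L = p ++ (a ++ x) :: m ++ (y ++ b) :: q
    & u = (join p : seq A) ++ a & v = (b : seq A) ++ join q.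

(** Induction on the height of [X]: synchronization carries a loose occurrence to the next level.
    The three heights may differ, so [W1] or [W2] may become a single letter before [X] does. *)
Lemma tower_no_overlap k k1 k2 n W1 W2 X u v :
  tower k X -> tower k1 W1 -> tower k2 W2 ->
  size (join X) = n -> size (join W1) = n -> size (join W2) = n ->
  0 < size u -> 0 < size v -> size u + size v = n ->
  ~ loose_occ u v (W1 ++ W2) X.
Proof.
move=> tX tW1 tW2 sX sW1 sW2 u0 v0 uv.
elim: k k1 k2 W1 W2 X tX tW1 tW2 sX sW1 sW2 => [|k IHk] k1 k2 W1 W2 X.
  case=> x -> tW1 tW2 sX sW1 sW2.
  case=> [p q a b x0 [<-] LE uE vE|p q [] // ].
  have {}sX : size (x : seq A) = n by rewrite -sX /join /= cats0.
  have sE (s t : seq (radix A)) (c : radix A) :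
      size (join (s ++ c :: t)) = size (join s) + (size (c : seq A) + size (join t)).
    by rewrite join_cat join_cons !size_cat.
  have sc : size (a ++ x ++ b : seq A) = size (a : seq A) + (n + size (b : seq A)).
    by rewrite -sX -!size_cat.
  (* The letter containing [x] lies in [W2] or in [W1]; both have length [n], which forces [v],
     resp. [u], to be empty. *)
  have [[r _ W2E]|[c [r [W1E cE]]]] := cat_overlap LE.
    by move: sW2 v0; rewrite W2E vE sE sc !size_cat; lia.
  case: cE W1E => <- _ W1E.
  by move: sW1 u0; rewrite W1E uE sE sc !size_cat; lia.
move=> [Xs [dXs XE tXs]] tW1 tW2 sX sW1 sW2.
have X3 : X = [::] \/ 2 < size X.
  rewrite XE; case: (Xs) dXs => [|g Xs'] dXs' /=; [by left | right].
  have [_ g3] := superdip_size (dXs' _ (mem_head _ _)).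
  by rewrite size_cat; apply: leq_trans g3 (leq_addr _ _).
case=> [p q a b x X1|p q m a b x y X2 LE uE vE].
  by case: X3; rewrite X1.
have {}X3 : 0 < size m.
  by case: X3; rewrite X2 //= size_rcons.
have xle : (x <= (a ++ x : radix A))%O := radix_le_catl a x.
have yle : (y <= (y ++ b : radix A))%O := radix_le_catr y b.
have XE2 : flatten Xs = x :: rcons m y by rewrite -XE.
(* If [W1] is one letter, it is [a ++ x], and [W2] begins with [X] deprived of its first letter and
   with its last letter raised. *)
case: k1 tW1 => [[w W1E]|k1 [Ws1 [dWs1 W1E tWs1]]].
  have sw : size (w : seq A) = n by rewrite -sW1 W1E /join /= cats0.
  case: p LE uE => [|w' p] LE uE; last first.
    move: LE u0 v0 uv; rewrite W1E uE => -[<- _].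
    by rewrite join_cons !size_cat sw; lia.
  move: LE; rewrite W1E => -[_ W2E].
  case: k2 tW2 => [[w2 W2E2]|k2 [Ws2 [dWs2 W2E2 _]]].
    by move: X3 (congr1 size W2E); rewrite W2E2 /= size_cat /=; lia.
  have [|Xs' dXs' Xs'E] := superdips_incr_last (s := x :: m) dXs _ yle.
    by rewrite XE2.
  apply: (superdips_no_behead (q := q) dWs2 dXs' Xs'E).
  by rewrite -W2E2 W2E cat_rcons.
(* Symmetrically, [W1] would end with [X] deprived of its last letter and with its first letter
   raised. *)
case: k2 tW2 => [[w W2E]|k2 [Ws2 [dWs2 W2E tWs2]]].
  have sw : size (w : seq A) = n by rewrite -sW2 W2E /join /= cats0.
  case/lastP: q LE vE => [|q w'] LE vE; last first.
    move: LE u0 v0 uv; rewrite W2E vE cats1 -!(rcons_cat, rcons_cons).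
    move=> /rcons_inj [_ <-]; rewrite -cats1 join_cat /join /= cats0 !size_cat sw.
    by lia.
  move: LE; rewrite W2E !cats1 -!(rcons_cat, rcons_cons) => /rcons_inj [W1E2 _].
  have [Xs' dXs' Xs'E] := superdips_incr_head dXs XE2 xle.
  apply: (superdips_no_belast (s := (a ++ x : radix A) :: m) dWs1 dXs' Xs'E).
  by rewrite -W1E W1E2.
have dWs : {in Ws1 ++ Ws2, forall g, is_superdip g}.
  by move=> g; rewrite mem_cat => /orP[/dWs1|/dWs2].
have WE : flatten (Ws1 ++ Ws2) = p ++ (a ++ x) :: m ++ (y ++ b) :: q.
  by rewrite flatten_cat -W1E -W2E.
have [V1 [V2 [p' [q' [pE qE alt]]]]] := superdips_loose_sync dWs dXs WE XE2 xle yle.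
apply: (IHk k1 k2 (map join Ws1) (map join Ws2) (map join Xs)) => //.
- by rewrite -join_flatten -XE.
- by rewrite -join_flatten -W1E.
- by rewrite -join_flatten -W2E.
have uE' : u = (join (map join V1) : seq A) ++ ((join p' : seq A) ++ a).
  by rewrite uE pE join_cat join_flatten catA.
have vE' : v = ((b : seq A) ++ join q') ++ join (map join V2).
  by rewrite vE qE join_cat join_flatten catA.
case: alt => [[-> VE]|[g [M [h [-> VE]]]]].
  apply: (@LooseOne _ _ _ _ (map join V1) (map join V2) _ _ _ _ _ uE' vE') => //.
  rewrite -map_cat VE map_cat /=; congr (_ ++ _ :: _).
  by rewrite !(join_cat, join_cons) -cats1 !(join_cat, join_cons) -!catA /=.
apply: (@LooseMany _ _ _ _ (map join V1) (map join V2) (map join M) _ _ _ _ _ _ uE' vE').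
  by rewrite /= map_rcons.
rewrite -map_cat VE map_cat /= map_cat /=; congr (_ ++ _ :: _ ++ _ :: _).
  by rewrite !(join_cat, join_cons) -!catA.
by rewrite -cats1 !(join_cat, join_cons) -!catA.
Qed.

End Tower.

(** * Comma-freeness from the absence of overlaps *)

Section CommaFreeCode.
Variable A : eqType.
Implicit Types (X : seq A -> Prop) (u v w x : seq A) (W : seq (seq A)).

Lemma comma_free_of_no_overlap m X : 0 < m -> (forall x, X x -> size x = m) ->
  (forall w1 w2 x u v, X w1 -> X w2 -> X x -> w1 ++ w2 = u ++ x ++ v ->
     u = [::] \/ v = [::]) ->
  comma_free_code m X.
Proof.
move=> m0 sX no_overlap.
have aligned W x u v : {in W, forall w, X w} -> X x -> flatten W = u ++ x ++ v ->
    exists W1 W2, [/\ W = W1 ++ x :: W2, u = flatten W1 & v = flatten W2].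
  move=> + Xx; elim: W u => [|w W IHW] u XW E.
    by move: (congr1 size E); rewrite !size_cat (sX _ Xx) /=; lia.
  have Xw := XW _ (mem_head _ _).
  have {}XW : {in W, forall w, X w} by move=> y yW; apply: XW; rewrite inE yW orbT.
  have [[r uE /(IHW _ XW) [W1 [W2 [-> rE vE]]]]|[a [r [wE xE]]]] := cat_overlap E.
    by exists (w :: W1), W2; rewrite uE rE.
  case: u wE {E} => [|b u] wE.
    have [-> ->] : x = a :: r /\ v = flatten W.
      by apply: (cat_eq_size (u := a :: r) xE); rewrite (sX _ Xx) -(sX _ Xw) wE.
    by exists [::], W; rewrite wE.
  have ar : size (a :: r) < m by rewrite -(sX _ Xw) wE size_cat ltnS leq_addl.
  case: W XW xE {IHW} => [|w' W] XW xE.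
    by move: (congr1 size xE) ar; rewrite /= !size_cat (sX _ Xx) /=; lia.
  have Xw' := XW _ (mem_head _ _).
  (* Since [x] starts strictly inside [w] and all lengths are [m], it ends within the next word
     [w']. *)
  rewrite /= -cat_cons catA in xE.
  have [|v' arE vE] := cat_leq_prefix xE.
    by rewrite size_cat (sX _ Xx) (sX _ Xw') leq_addl.
  have [|//|v'0] := no_overlap w w' x (b :: u) v' Xw Xw' Xx.
    by rewrite wE -catA -arE.
  by move: (congr1 size arE); rewrite v'0 /= !size_cat (sX _ Xx) (sX _ Xw') /=; lia.
split=> // _ u v [[|x V] [// _ XV ->]] [W [XW /= /esym E]].
rewrite -catA in E.
have Xx := XV _ (mem_head _ _).
have [W1 [W2 [WE -> E2]]] := aligned _ _ _ _ XW Xx E.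
split; first by exists W1; split => // w wW; apply: XW; rewrite WE mem_cat wW.
have {}XV : {in V, forall w, X w} by move=> y yV; apply: XV; rewrite inE yV orbT.
have {WE XW} XW2 : {in W2, forall w, X w}.
  by move=> w wW; apply: XW; rewrite WE mem_cat inE wW !orbT.
(* The remaining factors are peeled off from the left until only [v] is left. *)
elim: V W2 XV E2 XW2 {E} => [|y V IHV] W2 XV; first by exists W2.
have Xy := XV _ (mem_head _ _).
rewrite /= -catA => /esym E XW2.
have [W3 [W4 [W2E W3E E2]]] := aligned _ _ [::] _ XW2 Xy E.
apply: (IHV W4) => // w wV; first by apply: XV; rewrite inE wV orbT.
by apply: XW2; rewrite W2E mem_cat inE wV !orbT.
Qed.

End CommaFreeCode.

Section CommaFree.
Context {d : Order.disp_t} {A : orderType d}.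
Implicit Types (u v w x : seq A).

Lemma iter_superdips_no_overlap n1 n2 n w1 w2 x u v :
  iter_superdips n1 w1 -> iter_superdips n2 w2 -> iter_superdips n x ->
  size w1 = size x -> size w2 = size x -> w1 ++ w2 = u ++ x ++ v ->
  u = [::] \/ v = [::].
Proof.
(* The finest level consists of one-letter words, so words of different levels can be compared
   there. *)
have letters k w : iter_superdips k w ->
    tower k [seq ([:: a] : radix A) | a <- w].
  move=> /(@tower_exists _ _ 0) [W [SW <- tW]]; suff : [seq [:: a] | a <- join W] = W.
    by move=> ->.
  elim: W SW {tW} => //= a W IHW SW; have [b ab] := SW _ (mem_head _ _).
  rewrite ab /= IHW // => y yW; apply: SW.
  by rewrite inE yW orbT.
move=> /letters t1 /letters t2 /letters tx s1 s2 E.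
case: (posnP (size u)) => [/size0nil|u0]; first by left.
case: (posnP (size v)) => [/size0nil|v0]; first by right.
have sj w : size (join [seq ([:: a] : radix A) | a <- w]) = size w.
  by rewrite /join flatten_seq1.
exfalso; apply: (tower_no_overlap tx t1 t2 (sj x) _ _ u0 v0).
- by rewrite sj.
- by rewrite sj.
- by move: (congr1 size E); rewrite !size_cat; lia.
rewrite -map_cat E !map_cat.
set U := map _ u; set V := map _ v.
have uE : u = (join U : seq A) ++ [::] by rewrite cats0 /join flatten_seq1.
have vE : v = ([::] : seq A) ++ join V by rewrite /join flatten_seq1.
case: x {tx} s1 s2 E => [|a x] s1 s2 E.
  by move: (congr1 size E); rewrite !size_cat s1 s2 /=; lia.
case/lastP: x {s1 s2 E} => [|x b].
  exact: (@LooseOne _ _ _ _ _ _ U V [::] [::] [:: a] _ _ uE vE).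
apply: (@LooseMany _ _ _ _ _ _ U V (map (fun a => [:: a]) x) [::] [::] [:: a] [:: b] _ _ uE vE).
  by rewrite /= map_rcons.
by rewrite /= map_rcons -cats1 -catA.
Qed.
End CommaFree.

(** * Conjugacy and powers *)

Section Conjugate.
Variable A : eqType.
Implicit Types (s t u v w x : seq A).

Lemma conjugate_refl w : conjugate w w.
Proof. by exists w, [::]; rewrite cats0. Qed.

Lemma conjugate_rot w s t : conjugate w (s ++ t) -> conjugate w (t ++ s).
Proof.
case=> u [v [-> /cat_overlap [[r vE ->]|[a [r [sE ->]]]]]].
  by exists (u ++ s), r; rewrite vE -!catA.
by exists (a :: r), (t ++ v); rewrite sE /= -!catA.
Qed.

Lemma conjugate_trans u v w : conjugate u v -> conjugate v w -> conjugate u w.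
Proof. by move=> uv [s [t [vE ->]]]; apply: conjugate_rot; rewrite -vE. Qed.

Lemma conjugate_mem w x : conjugate w x -> w =i x.
Proof. by case=> u [v [-> ->]] a; rewrite !mem_cat orbC. Qed.

Lemma conjugate_size w x : conjugate w x -> size w = size x.
Proof. by case=> u [v [-> ->]]; rewrite !size_cat addnC. Qed.

(** Rotating a power by one letter rotates its base by one letter; the letters of [v] are moved one
    at a time. *)
Lemma conjugate_power w x k : conjugate w (flatten (nseq k x)) ->
  exists2 y, size y = size x & w = flatten (nseq k y).
Proof.
case=> u [v [-> /esym]]; elim: v u x => [|a v IHv] u x /=.
  by rewrite cats0 => uE; exists x.
case: x => [|b x].
  by have -> : flatten (nseq k [::]) = [::] :> seq A by elim: (k).
case: k IHv => // k IHv /= [<- E].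
have power_rot n : flatten (nseq n (a :: x)) ++ [:: a] =
    a :: flatten (nseq n (rcons x a)).
  by elim: n => //= n IHn; rewrite -catA IHn -cats1 -catA.
have [|y sy yE] := IHv (rcons u a) (rcons x a); last first.
  by exists y; [rewrite sy size_rcons | rewrite -cat_rcons yE].
by rewrite /= -rcons_cat E -[in LHS]cats1 -catA power_rot cat_rcons.
Qed.

End Conjugate.

Lemma conjugate_flatten (A : eqType) (V W : seq (seq A)) :
  conjugate V W -> conjugate (flatten V) (flatten W).
Proof.
by case=> U1 [U2 [-> ->]]; exists (flatten U1), (flatten U2); rewrite !flatten_cat.
Qed.

(** * Rotating words of odd length into products of superdips *)

Section CyclicSuperdips.
Context {d : Order.disp_t} {T : orderType d}.
Implicit Types (s t r : seq T).
Local Open Scope order_scope.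

Lemma seq_min s : s <> [::] -> exists2 y, y \in s & {in s, forall x, y <= x}.
Proof.
elim: s => // a [|b s] IHs _.
  by exists a; rewrite ?mem_head // => x; rewrite inE => /eqP->.
have [//|y ys ymin] := IHs; have [ay|ya] := leP a y.
  exists a; rewrite ?mem_head // => x; rewrite inE => /orP[/eqP-> //|/ymin].
  exact: le_trans.
exists y; first by rewrite inE ys orbT.
by move=> x; rewrite inE => /orP[/eqP->|/ymin //]; exact: ltW.
Qed.

Lemma min_rotation s : s <> [::] -> (forall k y, s <> nseq k y) ->
  exists t y z, [/\ conjugate s (t ++ [:: y; z]), y < z & {in t, forall x, y <= x}].
Proof.
move=> /seq_min [y ys ymin] s_nconst.
have [s1 [s2 sE]] : exists s1 s2, s = s1 ++ y :: s2.
  by case/splitPr: ys => s1 s2; exists s1, s2.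
have conj_s : conjugate s (y :: s2 ++ s1).
  by exists s1, (y :: s2).
(* Reading cyclically from [y], [z] is the first letter different from [y]; the letter before it is
   again [y]. *)
have [r_const|[i [z [r' [zy rE]]]]] : s2 ++ s1 = nseq (size (s2 ++ s1)) y \/
    exists i z r', z != y /\ s2 ++ s1 = nseq i y ++ z :: r'.
  elim: (s2 ++ s1) => [|a r [rE|[i [z [r' [zy ->]]]]]]; first by left.
    have [->|ay] := eqVneq a y; first by left; rewrite rE /= size_nseq.
    by right; exists 0, a, r.
  have [->|ay] := eqVneq a y; right; first by exists i.+1, z, r'.
  by exists 0, a, (nseq i y ++ z :: r').
- have s_const : s = nseq (size s) y.
    apply/all_pred1P/allP => x; rewrite (conjugate_mem conj_s) inE r_const.
    by rewrite mem_nseq => /orP[|/andP[]].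
  by case: (s_nconst _ _ s_const).
have conj_s' : conjugate s ((r' ++ nseq i y) ++ [:: y; z]).
  rewrite -catA; apply: conjugate_rot; rewrite -catA /=.
  have -> : nseq i y ++ [:: y, z & r'] = y :: nseq i y ++ z :: r'.
    by elim: (i) => //= n ->.
  by rewrite -rE.
exists (r' ++ nseq i y), y, z; split => //.
  rewrite lt_neqAle eq_sym zy ymin //.
  by rewrite (conjugate_mem conj_s') mem_cat !inE eqxx !orbT.
by move=> x xt; apply: ymin; rewrite (conjugate_mem conj_s') mem_cat xt.
Qed.

(** Greedy reading: [r] is the pending nonincreasing part, closed into a dip at each ascent. *)
Lemma dips_parse s : exists ds r,
  [/\ all is_dip ds, s = flatten ds ++ r & sorted >=%O r].
Proof.
elim/last_ind: s => [|s c [ds [r [dds -> sr]]]]; first by exists [::], [::].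
case/lastP: r sr => [|r b] sr; first by exists ds, [:: c]; rewrite cats0 cats1.
have [bc|cb] := ltP b c.
  exists (rcons ds (rcons (rcons r b) c)), [::].
  rewrite all_rcons dds andbT flatten_rcons rcons_cat cats0; split => //.
  by apply/is_dipP; exists r, b, c.
exists ds, (rcons (rcons r b) c); split => //; first by rewrite rcons_cat.
case: r sr => [|a r] /=; first by rewrite andbT.
by move=> srb; rewrite rcons_path srb last_rcons.
Qed.

Lemma min_dips_parse t y z : y < z -> {in t, forall x, y <= x} ->
  exists2 ds, all is_dip ds & t ++ [:: y; z] = flatten ds.
Proof.
move=> yz ymin; have [ds [r [dds tE sr]]] := dips_parse (rcons t y).
case/lastP: r tE sr => [|r b].
  (* An empty remainder would make the minimal letter [y] the top of an ascent. *)
  case/lastP: ds dds => [|ds e]; first by rewrite cats0; case: (t).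
  rewrite all_rcons flatten_rcons cats0 => /andP[/dip_ends [p [a [b [-> ab]]]] _] E _.
  move: E; rewrite catA -(cat1s a) catA !cats1 => /rcons_inj [tE yb].
  by move: ab; rewrite -yb ltNge ymin // tE mem_rcons mem_head.
rewrite -rcons_cat => /rcons_inj [tE <-] sr.
exists (rcons ds (rcons (rcons r y) z)).
  by rewrite all_rcons dds andbT; apply/is_dipP; exists r, y, z.
by rewrite flatten_rcons tE -!cats1 -!catA.
Qed.

(** A superdip is opened at each odd dip; the even dips [es] before the first odd one are left
    over. *)
Lemma dips_group ds : all is_dip ds -> exists es (G : seq (seq (seq T))),
  [/\ ds = es ++ flatten G, all even_dip es & all is_superdip_seq G].
Proof.
elim: ds => [|x ds IHds] /=; first by exists [::], [::].
move=> /andP[dx /IHds [es [G [-> des dG]]]].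
have [ox|ox] := boolP (odd (size x)).
  by exists [::], ((x :: es) :: G); rewrite /= dx ox des.
by exists (x :: es), G; rewrite /= /even_dip dx ox.
Qed.

Lemma cyclic_superdips s : odd (size s) -> (forall k y, s <> nseq k y) ->
  exists W : seq (seq T),
    [/\ {in W, forall w, is_superdip w}, conjugate s (flatten W), odd (size W)
      & (size W < size s)%N].
Proof.
move=> os s_nconst.
have [|t [y [z [conj_s yz ymin]]]] := min_rotation _ s_nconst.
  by move=> s0; rewrite s0 in os.
have [ds dds tE] := min_dips_parse yz ymin.
have [es [G [dsE des dG]]] := dips_group dds.
have oes : odd (size (flatten es)) = false.
  elim: (es) des => //= e es' IHes /andP[/andP[_ oe] /IHes].
  by rewrite size_cat oddD (negbTE oe).
move: conj_s; rewrite tE dsE flatten_cat => conj_s.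
have [G' [dG' conj_s']] : exists G', all is_superdip_seq G' /\
    conjugate s (flatten (flatten G')).
  (* [G] is nonempty because the total length is odd; the leftover even dips are rotated to the end,
     into the last superdip. *)
  case/lastP: G dG conj_s {dsE} => [|G g] dG conj_s.
    by move: os; rewrite (conjugate_size conj_s) cats0 oes.
  exists (rcons G (g ++ es)); split.
    move: dG; rewrite !all_rcons; case: g {conj_s} => //= x g.
    by rewrite all_cat des andbT.
  rewrite flatten_rcons catA -flatten_rcons flatten_cat.
  exact: conjugate_rot.
have [W dW WE] : exists2 W : seq (seq T), {in W, forall w, is_superdip w} &
    flatten (flatten G') = flatten W.
  exists (map flatten G'); last exact: flatten_seq.
  by move=> w /mapP [g gG ->]; exists g => //; exact: (allP dG').
rewrite WE in conj_s'; exists W.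
have sW := conjugate_size conj_s'.
have [oW W3] : odd (size (flatten W)) = odd (size W) /\
    (3 * size W <= size (flatten W))%N.
  elim: (W) dW => //= w V IHV dV.
  have [|oV V3] := IHV; first by move=> v vV; apply: dV; rewrite inE vV orbT.
  have [ow w3] := superdip_size (dV _ (mem_head _ _)).
  by rewrite size_cat oddD ow oV mulnS; split => //; exact: leq_add.
split => //; first by rewrite -oW -sW.
by move: os W3; rewrite sW; case: (size (flatten W)) => // n _; lia.
Qed.

End CyclicSuperdips.

Lemma conjugate_iter_superdips d (A : orderType d) n (W : seq (radix A)) (w : seq A) :
  odd (size W) -> {in W, forall x, iter_superdips n x} ->
  conjugate w (join W) -> primitive w -> 0 < size w ->
  exists x, (exists k, iter_superdips k x) /\ conjugate w x.
Proof.
elim/ltn_ind: (size W) {-2}W (erefl (size W)) n => N IHN {}W WN n oW SW conj_w wprim w0.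
have [W1|W1] := eqVneq (size W) 1.
  case: W W1 SW conj_w {WN oW} => [|x [|]] // _ SW.
  rewrite join_cons cats0 => conj_w; exists x; split => //.
  by exists n; apply: SW; rewrite mem_head.
have [|V [dV conj_W oV VW]] := cyclic_superdips oW _.
  (* If [W] were constant, [w] would be a [k]-th power; [k] is odd and not 1, so the base is shorter
     than [w], against primitivity. *)
  move=> k y WE; move: conj_w; rewrite WE => /conjugate_power [x _ wE].
  apply: wprim; exists x, k; split => // xw; move: (congr1 size wE).
  rewrite -xw size_flatten /shape map_nseq sumn_nseq; move: oW W1 w0.
  rewrite WE size_nseq -xw; case: k {WE wE} => [|[|k]] // _ _.
  by case: (size x) => // l _; nia.
apply: (IHN (size V) _ (map join V) _ n.+1) => //.
- by rewrite -WN.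
- by rewrite size_map.
- by rewrite size_map.
- move=> _ /mapP [v vV ->]; exists v; split => //.
  apply/superdipsP; split; last exact: dV.
  move=> x xv; apply: SW; rewrite (conjugate_mem conj_W).
  by apply/flattenP; exists v.
rewrite -join_flatten; apply: conjugate_trans conj_w _.
exact: (conjugate_flatten (A := A)).
Qed.

Theorem proposition16 (d : Order.disp_t) (A : orderType d)
    (card_A : exists a b : A, a != b) (m : nat) (m_odd : odd m) :
  let X := fun w : seq A => size w = m /\ exists n : nat, iter_superdips n w in
  comma_free_code m X /\
  (forall w : seq A, primitive w -> size w = m ->
     exists x : seq A, X x /\ conjugate w x).
Proof.
move=> X; split.
  apply: comma_free_of_no_overlap; first by case: (m) m_odd.
    by move=> x [].
  move=> w1 w2 x u v [s1 [n1 S1]] [s2 [n2 S2]] [sx [n Sx]].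
  by apply: (iter_superdips_no_overlap S1 S2 Sx); rewrite sx.
move=> w wprim sw.
have [|||||x [Sx wx]] :=
  @conjugate_iter_superdips _ A 0 [seq ([:: a] : radix A) | a <- w] w.
- by rewrite size_map sw.
- by move=> _ /mapP [a _ ->]; exists a.
- rewrite /join flatten_seq1; exact: conjugate_refl.
- exact: wprim.
- by rewrite sw; case: (m) m_odd.
by exists x; split => //; split => //; rewrite -(conjugate_size wx).
Qed.
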